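(* Let $(V_\bullet,f_\bullet)$ be a persistence module $V_0\xrightarrow{f_1}V_1\to\cdots\xrightarrow{f_\ell}V_\ell$ of finite-dimensional vector spaces over a field $\mathbb{F}$, with $n_i=\dim V_i$. Let $\mathscr{B}$ be an ordered barcode basis of $(V_\bullet,f_\bullet)$ and let $A_\bullet=(A_1,\dots,A_\ell)$ be the matrices of $f_1,\dots,f_\ell$ with respect to $\mathscr{B}$. Then the set of all ordered barcode bases of $(V_\bullet,f_\bullet)$ is the orbit $\mathrm{Stab}(A_\bullet)\,\mathscr{B}=\{g\mathscr{B} : g\in\mathrm{Stab}(A_\bullet)\}$, where $$\mathrm{Stab}(A_\bullet)=\Big\{g\in\prod_{i=0}^{\ell}\mathrm{GL}(n_i;\mathbb{F}) : g_iA_ig_{i-1}^{-1}=A_i\text{ for all }1\le i\le\ell\Big\}.$$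
   Context: A basis family $\mathscr{B}=(B_i)_{0\le i\le\ell}$ consists of an ordered basis $B_i$ of each $V_i$. The group $G=\prod_{i=0}^\ell\mathrm{GL}(n_i;\mathbb{F})$ acts freely and transitively on basis families by change of basis: $g\mathscr{B}=(g_iB_i)_i$ is the basis family such that $g_i$ is the matrix converting $B_i$-coordinates into $g_iB_i$-coordinates on $V_i$. Thus if $f_i$ has matrix $A_i$ with respect to $\mathscr{B}$, it has matrix $g_iA_ig_{i-1}^{-1}$ with respect to $g\mathscr{B}$. The interval module $\mathbf{I}[i,j]_\bullet$ has $\mathbb{F}$ in positions $i,\dots,j$, $0$ elsewhere, identity maps between consecutive copies of $\mathbb{F}$; every persistence module is isomorphic to $\bigoplus_{0\le i\le j\le\ell}\mathbf{I}[i,j]_\bullet^{d_{ij}}$ for unique $d_{ij}\ge0$. An ordered barcode basis is a basis family obtained from such a decomposition with the bars ordered lexicographically: there are vectors $v^{[i,j],m}_k\in V_k$ for $0\le i\le j\le\ell$, $1\le m\le d_{ij}$, $i\le k\le j$, such that $f_{k+1}(v^{[i,j],m}_k)=v^{[i,j],m}_{k+1}$ for $i\le k<j$, $f_{j+1}(v^{[i,j],m}_j)=0$ if $j<\ell$, and for each $k$ the vectors $v^{[i,j],m}_k$ with $i\le k\le j$ form the basis $B_k$, ordered first by the lexicographic order on $[i,j]$ ($[a,b]\trianglelefteq[c,d]$ iff $a<c$, or $a=c$ and $b\le d$) and then by $m$. *)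

(* Defs.v *)
From HB Require Import structures.
From mathcomp Require Import all_boot all_order all_algebra.
Set Implicit Arguments. Unset Strict Implicit. Unset Printing Implicit Defensive.
Import GRing.Theory.
Local Open Scope ring_scope.

(* For i : 'I_l, [src i] is the position i and [tgt i] the position i + 1. *)
Definition src (l : nat) (i : 'I_l) : 'I_l.+1 := widen_ord (leqnSn l) i.
Definition tgt (l : nat) (i : 'I_l) : 'I_l.+1 := lift ord0 i.

(* The maps are indexed by their source: [pm_map V i] is f_{i+1}. *)
Record persistence_module (F : fieldType) (l : nat) := PersistenceModule {
  pm_space :> 'I_l.+1 -> vectType F;
  pm_map : forall i : 'I_l, 'Hom(pm_space (src i), pm_space (tgt i))
}.

Section BasisFamilies.
Variables (F : fieldType) (l : nat) (V : persistence_module F l).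

Definition pm_dim (k : 'I_l.+1) : nat := \dim {: V k}.

Record basis_family := BasisFamily {
  bf_val :> {dffun forall k : 'I_l.+1, (pm_dim k).-tuple (V k)};
  bf_valP : [forall k, basis_of fullv (bf_val k)]
}.
HB.instance Definition _ := [isSub for bf_val].

(* The carrier of the product of the groups GL(n_k; F); ['GL_n[F]] is not used
   because it requires F finite and n > 0. *)
Record GL_family := GLFamily {
  gl_val :> {dffun forall k : 'I_l.+1, 'M[F]_(pm_dim k)};
  gl_valP : [forall k, gl_val k \in unitmx]
}.
HB.instance Definition _ := [isSub for gl_val].

Definition coords n k (X : n.-tuple (V k)) (v : V k) : 'cV[F]_n :=
  \col_r coord X r v.

(* Since g_k converts B_k-coordinates into g_k B_k-coordinates, the columns of
   its inverse are the B_k-coordinates of the vectors of g_k B_k. *)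
Definition change_basis (g : GL_family) (B : basis_family) :
    {dffun forall k : 'I_l.+1, (pm_dim k).-tuple (V k)} :=
  [ffun k => [tuple \sum_r invmx (g k) r c *: tnth (B k) r | c < pm_dim k]].

Lemma change_basis_inv (g : GL_family) (B : basis_family) k c :
  tnth (B k) c = \sum_r g k r c *: tnth (change_basis g B k) r.
Proof.
have gU : g k \in unitmx by have /forallP := gl_valP g.
transitivity (\sum_s (invmx (g k) *m g k) s c *: tnth (B k) s).
  rewrite mulVmx // (bigD1 c) //= big1 ?addr0 => [|s sNc].
    by rewrite mxE eqxx scale1r.
  by rewrite mxE (negPf sNc) scale0r.
under [RHS]eq_bigr => r _ do rewrite ffunE tnth_mktuple scaler_sumr.
rewrite exchange_big /=; apply: eq_bigr => s _.
rewrite mxE scaler_suml; apply: eq_bigr => r _.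
by rewrite scalerA mulrC.
Qed.

Lemma change_basis_subproof (g : GL_family) (B : basis_family) :
  [forall k, basis_of fullv (change_basis g B k)].
Proof.
apply/forallP => k; have /forallP/(_ k) Bk := bf_valP B.
rewrite basisEdim size_tuple leqnn andbT -(span_basis Bk).
apply/span_subvP => _ /tnthP[c ->]; rewrite (change_basis_inv g).
by apply: memv_suml => r _; apply: memvZ; apply/memv_span/mem_tnth.
Qed.

Definition act (g : GL_family) (B : basis_family) : basis_family :=
  BasisFamily (change_basis_subproof g B).

Lemma act_coords (g : GL_family) (B : basis_family) k (v : V k) :
  coords (act g B k) v = g k *m coords (B k) v.
Proof.
have /forallP/(_ k) Bk := bf_valP B.
have /forallP/(_ k)/basis_free gBf := bf_valP (act g B).
have vE : v = \sum_r (g k *m coords (B k) v) r 0 *: (act g B k)`_r.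
  rewrite [LHS](coord_basis Bk (memvf v)).
  under eq_bigr => c _ do
    rewrite -tnth_nth (change_basis_inv g) scaler_sumr.
  rewrite exchange_big /=; apply: eq_bigr => r _.
  rewrite mxE scaler_suml -tnth_nth; apply: eq_bigr => c _.
  by rewrite scalerA !mxE mulrC.
by apply/colP => r; rewrite mxE {1}vE coord_sum_free.
Qed.

(* Columns are the images of the basis vectors, so that matrices act on the
   left; [mxof] from the library is the transpose. *)
Definition map_matrix (B : basis_family) (i : 'I_l) :
    'M[F]_(pm_dim (tgt i), pm_dim (src i)) :=
  \matrix_(r, c) coord (B (tgt i)) r (pm_map V i (tnth (B (src i)) c)).

Definition in_Stab
    (A : forall i : 'I_l, 'M[F]_(pm_dim (tgt i), pm_dim (src i)))
    (g : GL_family) : Prop :=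
  forall i : 'I_l, g (tgt i) *m A i *m invmx (g (src i)) = A i.

(* [v i j m k] is the vector at position k of the m-th bar [i,j]; its values
   outside i <= k <= j are irrelevant. *)
Definition bar_vectors (d : 'I_l.+1 -> 'I_l.+1 -> nat)
    (v : forall i j : 'I_l.+1, 'I_(d i j) -> forall k : 'I_l.+1, V k) : Prop :=
  forall (i j : 'I_l.+1) (m : 'I_(d i j)), (i <= j)%N ->
    (forall k : 'I_l, (i <= k < j)%N ->
       pm_map V k (v i j m (src k)) = v i j m (tgt k))
    /\ (forall k : 'I_l, k = j :> nat -> pm_map V k (v i j m (src k)) = 0).

(* As [enum 'I_n] is increasing, this lists the vectors lexicographically in
   (i, j, m). *)
Definition bars_at (d : 'I_l.+1 -> 'I_l.+1 -> nat)
    (v : forall i j : 'I_l.+1, 'I_(d i j) -> forall k : 'I_l.+1, V k)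
    (k : 'I_l.+1) : seq (V k) :=
  flatten [seq flatten [seq [seq v i j m k | m <- enum 'I_(d i j)]
                       | j : 'I_l.+1 <- enum 'I_l.+1 & (k <= j)%N]
          | i : 'I_l.+1 <- enum 'I_l.+1 & (i <= k)%N].

Definition ordered_barcode_basis (B : basis_family) : Prop :=
  exists (d : 'I_l.+1 -> 'I_l.+1 -> nat)
         (v : forall i j : 'I_l.+1, 'I_(d i j) -> forall k : 'I_l.+1, V k),
    bar_vectors v /\ (forall k : 'I_l.+1, bars_at v k = B k).

End BasisFamilies.

(* Main.v *)
(* The group acts transitively on basis families, and g stabilizes the matrices
   of B exactly when B and gB give the same matrices, so it suffices to show
   that a basis family is an ordered barcode basis iff its matrices are those of
   B. If they are, the linear maps sending B_k to B'_k form an automorphism of the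
   module and carry the bars of B to those of B'. Conversely, the ranks of the
   composites [V_i -> V_j] determine the multiplicities [d i j], and the order of
   the bars then determines every matrix entry. *)
Require Import Defs.
From mathcomp Require Import all_boot all_order all_algebra.
From mathcomp Require Import zify.
Set Implicit Arguments. Unset Strict Implicit. Unset Printing Implicit Defensive.
Import GRing.Theory.
Local Open Scope ring_scope.

(** * Coordinates, matrices and the group action *)

Section Coordinates.
Variables (F : fieldType) (l : nat) (V : persistence_module F l).
Implicit Types B : basis_family V.

Lemma bf_basis B k : basis_of fullv (B k).
Proof. by have /forallP := bf_valP B. Qed.

Lemma bf_free B k : free (B k).
Proof. exact: basis_free (bf_basis B k). Qed.

Lemma coords_expand B k (x : V k) :
  x = \sum_r coords (B k) x r 0 *: tnth (B k) r.
Proof.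
rewrite [LHS](coord_basis (bf_basis B k) (memvf x)).
by apply: eq_bigr => r _; rewrite mxE -tnth_nth.
Qed.

Lemma coords_inj B k : injective (coords (B k)).
Proof. by move=> x y xy; rewrite (coords_expand B x) xy -coords_expand. Qed.

Lemma coords_sum B k (a : 'I_(pm_dim V k) -> F) :
  coords (B k) (\sum_r a r *: tnth (B k) r) = \col_r a r.
Proof.
apply/colP => r; rewrite !mxE.
under eq_bigr do rewrite (tnth_nth 0).
by rewrite coord_sum_free // bf_free.
Qed.

Lemma coords_map B (i : 'I_l) (x : V (src i)) :
  coords (B (tgt i)) (pm_map V i x) = map_matrix B i *m coords (B (src i)) x.
Proof.
rewrite {1}(coords_expand B x) linear_sum; apply/colP => r; rewrite !mxE linear_sum.
by apply: eq_bigr => c _; rewrite !linearZ /= !mxE mulrC.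
Qed.

Lemma map_matrix_act (g : GL_family V) B (i : 'I_l) :
  map_matrix (act g B) i = g (tgt i) *m map_matrix B i *m invmx (g (src i)).
Proof.
have gU : g (src i) \in unitmx by have /forallP := gl_valP g.
suff E : map_matrix (act g B) i *m g (src i) = g (tgt i) *m map_matrix B i.
  by rewrite -E mulmxK.
apply/matrixP => r c.
(* Multiplying by this coordinate vector extracts column [c] on both sides. *)
have Ec : coords (B (src i)) (tnth (B (src i)) c) = delta_mx c 0.
  apply/colP => s; rewrite !mxE (tnth_nth 0) coord_free ?bf_free //.
  by rewrite eqxx andbT eq_sym.
have := coords_map (act g B) (tnth (B (src i)) c).
rewrite !act_coords coords_map Ec !mulmxA -!colE => /colP/(_ r).
by rewrite !mxE => ->.
Qed.

(** The transition matrices [c B' B] and [c B B'] are mutually inverse, so [c B' B] gives the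
    required group element. *)
Lemma act_transitive B B' : exists g : GL_family V, B' = act g B.
Proof.
pose c (X Y : basis_family V) k := \matrix_(r, s) coord (X k) r (tnth (Y k) s).
have cE (X Y : basis_family V) k (x : V k) : coords (X k) x = c X Y k *m coords (Y k) x.
  rewrite {1}(coords_expand Y x); apply/colP => r; rewrite !mxE linear_sum.
  by apply: eq_bigr => s _; rewrite linearZ /= !mxE mulrC.
have cV (X Y : basis_family V) k : c X Y k *m c Y X k = 1%:M.
  apply/matrixP => r s; have := cE X Y k (tnth (X k) s).
  move/colP/(_ r); rewrite !mxE {1}(tnth_nth 0) coord_free ?bf_free // eq_sym => ->.
  by apply: eq_bigr => t _; rewrite !mxE (tnth_nth 0).
pose g0 : {dffun forall k : 'I_l.+1, 'M[F]_(pm_dim V k)} := [ffun k => c B' B k].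
have g0P : [forall k, g0 k \in unitmx].
  by apply/forallP => k; rewrite ffunE; case: (mulmx1_unit (cV B' B k)).
exists (GLFamily g0P); apply/val_inj/ffunP => k /=; apply/eq_from_tnth => s.
rewrite !ffunE tnth_mktuple /=.
have -> : invmx (c B' B k) = c B B' k.
  rewrite -[LHS]mulmx1 -(cV B' B k) mulmxA mulVmx ?mul1mx //.
  by case: (mulmx1_unit (cV B' B k)).
rewrite [LHS](coords_expand B); apply: eq_bigr => r _.
by rewrite !mxE.
Qed.

End Coordinates.

(** * Indexing of bars and their multiplicities *)

Section Multiplicities.
Variables (l : nat).
Implicit Types (d : 'I_l.+1 -> 'I_l.+1 -> nat) (k : 'I_l.+1).

(* The triple [(i, j, m)] stands for the m-th copy of the bar [i,j]; taking m in
   nat makes families of bars with different multiplicities comparable. *)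
Definition bar_index : eqType := ('I_l.+1 * 'I_l.+1 * nat)%type.
Implicit Types t : bar_index.

(** The order is lexicographic. Pairs with [j < i] are listed too, but such bars are alive
    nowhere. *)
Definition bar_indices d : seq bar_index :=
  flatten [seq flatten [seq [seq (i, j, m) | m <- iota 0 (d i j)]
                       | j : 'I_l.+1 <- enum 'I_l.+1]
          | i : 'I_l.+1 <- enum 'I_l.+1].

Definition alive k t := (t.1.1 <= k <= t.1.2)%N.

Lemma bar_indicesP d t : (t \in bar_indices d) = (t.2 < d t.1.1 t.1.2)%N.
Proof.
case: t => [[i j] m] /=; apply/flattenP/idP => [[_ /mapP[i' _ ->]]|lt_m].
  by case/flattenP => _ /mapP[j' _ ->] /mapP[m' + [-> -> ->]]; rewrite mem_iota.
eexists; first by apply: map_f; rewrite mem_enum.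
apply/flattenP; eexists; first by apply: map_f; rewrite mem_enum.
by apply: map_f; rewrite mem_iota.
Qed.

Lemma count_bar_indices d (a : pred ('I_l.+1 * 'I_l.+1)) :
  count (fun t => a t.1) (bar_indices d) = (\sum_(p | a p) d p.1 p.2)%N.
Proof.
rewrite count_flatten -map_comp sumnE big_map big_enum [RHS]big_mkcond /=.
transitivity (\sum_i \sum_j if a (i, j) then d i j else 0)%N; last first.
  by rewrite pair_bigA; apply: eq_bigr => -[].
apply: eq_bigr => i _; rewrite count_flatten -map_comp sumnE big_map big_enum /=.
apply: eq_bigr => j _; rewrite count_map.
case: ifP => aij; last by rewrite (eq_count (a2 := pred0)) ?count_pred0.
by rewrite (eq_count (a2 := predT)) ?count_predT ?size_iota.
Qed.

(* Induction on [i + (l - j)]: in the hypothesis at [(i, j)] every other summand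
   is already known to agree. *)
Lemma multiplicities_unique d d' :
  (forall i j : 'I_l.+1, (i <= j)%N ->
     \sum_(p : 'I_l.+1 * 'I_l.+1 | (p.1 <= i) && (j <= p.2)) d p.1 p.2 =
     \sum_(p : 'I_l.+1 * 'I_l.+1 | (p.1 <= i) && (j <= p.2)) d' p.1 p.2)%N ->
  forall i j : 'I_l.+1, (i <= j)%N -> d i j = d' i j.
Proof.
move=> dd' i j; have [n] := ubnP (i + (l - j)).
elim: n i j => // n IH i j lt_n le_ij.
have := dd' i j le_ij.
rewrite (bigD1 (i, j)) /= ?leqnn // [RHS](bigD1 (i, j)) /= ?leqnn //.
rewrite (eq_bigr (fun p => d' p.1 p.2)) => [/addIn //|[a b]] /=.
case/andP=> /andP[le_ai le_jb] neq; apply: IH; last lia.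
(* So [a < i] or [j < b]; as [b <= l], the truncated subtraction also drops strictly in the second
   case. *)
have: (a != i :> nat) || (b != j :> nat) by move: neq; rewrite xpair_eqE negb_and.
have := ltn_ord b; have := ltn_ord j; lia.
Qed.

Lemma alive_indices_eq d d' k :
  (forall i j : 'I_l.+1, (i <= j)%N -> d i j = d' i j) ->
  filter (alive k) (bar_indices d) = filter (alive k) (bar_indices d').
Proof.
move=> dd'; rewrite !filter_flatten -!map_comp; congr flatten; apply: eq_map => i /=.
rewrite !filter_flatten -!map_comp; congr flatten; apply: eq_map => j /=.
have [le_ij|lt_ji] := leqP i j; first by rewrite dd'.
rewrite !filter_map !(eq_filter (a2 := pred0)) ?filter_pred0 // => m /=;
  rewrite /alive /=; lia.
Qed.

End Multiplicities.

(** * Ranks and matrices of barcode bases *)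

Section Barcodes.
Variables (F : fieldType) (l : nat) (V : persistence_module F l).
Implicit Types (B : basis_family V) (d : 'I_l.+1 -> 'I_l.+1 -> nat).

(** A flat form of [ordered_barcode_basis]: the type of [w] does not depend on [d], and one list of
    indices gives the position of each bar. *)
Definition indexed_barcode_basis d (w : bar_index l -> forall k, V k) B :=
  (forall (k : 'I_l) t, t \in filter (alive (src k)) (bar_indices d) ->
     pm_map V k (w t (src k)) = if alive (tgt k) t then w t (tgt k) else 0)
  /\ forall k, [seq w t k | t <- bar_indices d & alive k t] = B k.

Lemma tgtE (k : 'I_l) : tgt k = k.+1 :> nat.
Proof. by []. Qed.

Lemma barcode_basis_indexed B :
  ordered_barcode_basis B -> exists d w, indexed_barcode_basis d w B.
Proof.
case=> d [v [vbar vB]].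
(* The default 0 is never reached on [bar_indices d]. *)
pose w (t : bar_index l) k :=
  if insub t.2 is Some m then v t.1.1 t.1.2 m k else 0.
exists d, w; split=> [k [[i j] m]|k].
  rewrite mem_filter bar_indicesP /alive /= => /andP[/andP[le_ik le_kj] lt_m].
  rewrite /w /= insubT.
  have [vin vout] := vbar i j (Ordinal lt_m) (leq_trans le_ik le_kj).
  have -> : (i <= bump 0 k)%N by apply: leq_trans le_ik _; rewrite leqnSn.
  rewrite /bump /= add1n; case: ltnP => [lt_kj|le_jk]; first by rewrite vin ?le_ik.
  by rewrite vout //; apply/eqP; rewrite eqn_leq le_kj.
rewrite -vB filter_flatten map_flatten -2!map_comp /bars_at.
(* Replacing skipped entries by empty lists lets the nested lists be compared entry by entry. *)
have flt (T : eqType) (s : seq T) (p : pred T) S (h : T -> seq S) :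
    flatten [seq h x | x <- s & p x] =
    flatten [seq if p x then h x else [::] | x <- s].
  by elim: s => //= x s <-; case: (p x).
rewrite [RHS]flt; congr flatten; apply: eq_map => i /=.
rewrite filter_flatten map_flatten -2!map_comp.
case le_ik: (i <= k)%N; last first.
  rewrite (eq_map (g := fun=> [::])); first by elim: (enum _).
  move=> j /=; rewrite filter_map (eq_filter (a2 := pred0)) ?filter_pred0 //.
  by move=> m; rewrite /= /alive /= le_ik.
rewrite [RHS]flt; congr flatten; apply: eq_map => j /=; rewrite filter_map.
case le_kj: (k <= j)%N; last first.
  rewrite (eq_filter (a2 := pred0)) ?filter_pred0 // => m.
  by rewrite /= /alive /= le_kj andbF.
rewrite (eq_filter (a2 := predT)); last by move=> m; rewrite /= /alive /= le_ik.
rewrite filter_predT -val_enum_ord -!map_comp; apply: eq_map => m /=.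
by rewrite /w /= valK.
Qed.

(* The sum below is the rank of the composite [V i -> V j], whose image is
   spanned by the bars born up to i that are alive at j. These spans, for either
   barcode basis, start with [V i] at i and are then obtained by taking
   successive images. *)
Lemma barcode_rank d w B d' w' B' :
  indexed_barcode_basis d w B -> indexed_barcode_basis d' w' B' ->
  forall i j : 'I_l.+1, (i <= j)%N ->
    (\sum_(p : 'I_l.+1 * 'I_l.+1 | (p.1 <= i) && (j <= p.2)) d p.1 p.2 =
     \sum_(p : 'I_l.+1 * 'I_l.+1 | (p.1 <= i) && (j <= p.2)) d' p.1 p.2)%N.
Proof.
move=> wB wB' i j le_ij.
pose bars d (w : bar_index l -> forall k, V k) (k : 'I_l.+1) :=
  [seq w t k | t : bar_index l <- bar_indices d & (t.1.1 <= i) && (k <= t.1.2)]%N.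
have dim_bars e u X : indexed_barcode_basis e u X ->
    (\dim <<bars e u j>> =
     \sum_(p : 'I_l.+1 * 'I_l.+1 | (p.1 <= i) && (j <= p.2)) e p.1 p.2)%N.
  case=> _ uX; rewrite -count_bar_indices -size_filter -(size_map (u^~ j)).
  apply/eqP; change (free (bars e u j)); have := bf_free X j.
  pose p (t : bar_index l) := (t.1.1 <= i)%N.
  (* Reordering puts the bars born up to [i] first, as a prefix of a free family. *)
  rewrite -uX -(perm_free (perm_map _ (permEl (perm_filterC p _)))) map_cat.
  move/catl_free; rewrite -filter_predI /bars; congr (free (map _ _)).
  apply: eq_filter => t; rewrite /= /p /alive.
  by case: leqP => //= le_ti; rewrite (leq_trans le_ti).
have im0 e u X : indexed_barcode_basis e u X -> <<bars e u i>>%VS = fullv.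
  by case=> _ uX; rewrite -(span_basis (bf_basis X i)) -uX.
have imS e u X (k : 'I_l) : indexed_barcode_basis e u X -> (i <= src k)%N ->
    <<bars e u (tgt k)>>%VS = (pm_map V k @: <<bars e u (src k)>>)%VS.
  case=> umap _ le_ik; rewrite limg_span -map_comp.
  have image t : t \in bar_indices e -> (t.1.1 <= i)%N -> (src k <= t.1.2)%N ->
      pm_map V k (u t (src k)) = if (tgt k <= t.1.2)%N then u t (tgt k) else 0.
    move=> te le_ti le_kt; rewrite umap.
      by rewrite /alive (leq_trans le_ti) // (leq_trans le_ik) // tgtE.
    by rewrite mem_filter /alive le_kt te (leq_trans le_ti).
  apply/eqP; rewrite eqEsubv; apply/andP; split; apply/span_subvP => x /mapP[t].
    rewrite mem_filter => /andP[/andP[le_ti lt_kt] te ->].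
    have le_kt : (src k <= t.1.2)%N by rewrite ltnW.
    apply/memv_span/mapP; exists t; first by rewrite mem_filter le_ti le_kt.
    by rewrite /= image // lt_kt.
  rewrite mem_filter => /andP[/andP[le_ti le_kt] te ->] /=; rewrite image //.
  case: ifP => [lt_kt|_]; last exact: mem0v.
  by apply/memv_span/map_f; rewrite mem_filter le_ti lt_kt.
rewrite -(dim_bars _ _ _ wB) -(dim_bars _ _ _ wB'); congr (\dim _).
move: {-2}j (erefl j) le_ij => k _; clear dim_bars j.
have [n] := ubnP k; elim: n k => // n IH k lt_kn.
rewrite leq_eqVlt => /orP[/eqP/val_inj <-|]; first by rewrite (im0 _ _ _ wB) (im0 _ _ _ wB').
(* A position beyond [i] is not 0, hence is the target of some map. *)
case: (unliftP ord0 k) lt_kn => [k' ->|->]; last by rewrite ltn0.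
rewrite -/(tgt k') tgtE => lt_kn le_ik.
rewrite (imS _ _ _ _ wB) // (imS _ _ _ _ wB') //; congr (_ @: _)%VS.
exact: IH.
Qed.

(** Both matrices are read off from the shared [d]: a bar alive at [src i] has a single 1 in its
    column, at its position among the bars alive at [tgt i], or a zero column if it ends at
    [src i]. *)
Lemma barcode_map_matrix d w B w' B' :
  indexed_barcode_basis d w B -> indexed_barcode_basis d w' B' ->
  (forall i, map_matrix B i = map_matrix B' i).
Proof.
pose t0 : bar_index l := (ord0, ord0, 0%N).
suff E u X : indexed_barcode_basis d u X -> forall i, map_matrix X i =
    \matrix_(r, c) let t := nth t0 (filter (alive (src i)) (bar_indices d)) c in
    (alive (tgt i) t && (r == index t (filter (alive (tgt i)) (bar_indices d)) :> nat))%:R.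
  by move=> wB wB' i; rewrite (E _ _ wB) (E _ _ wB').
case=> umap uX i; apply/matrixP => r c; rewrite !mxE.
have lt_c : (c < size (filter (alive (src i)) (bar_indices d)))%N.
  by rewrite -(size_map (u^~ (src i))) uX size_tuple.
rewrite (tnth_nth 0) -uX (nth_map t0) //=.
have := mem_nth t0 lt_c; set t := nth _ _ _; rewrite mem_filter => /andP[ts td].
rewrite umap ?mem_filter ?ts //; case: ifP => /= [tt|_]; last by rewrite linear0.
have tin : t \in filter (alive (tgt i)) (bar_indices d) by rewrite mem_filter tt.
have lt_t : (index t (filter (alive (tgt i)) (bar_indices d)) < pm_dim V (tgt i))%N.
  by rewrite -(size_tuple (X (tgt i))) -uX size_map index_mem.
have -> : u t (tgt i) = (X (tgt i))`_(Ordinal lt_t).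
  by rewrite -uX (nth_map t0) ?index_mem // nth_index.
by rewrite coord_free ?bf_free // eq_sym.
Qed.

(* The linear maps sending [B k] to [B' k] commute with the module maps when the
   two matrices coincide, so they carry bars to bars. *)
Lemma barcode_basis_transport B B' :
  (forall i, map_matrix B i = map_matrix B' i) -> ordered_barcode_basis B ->
  ordered_barcode_basis B'.
Proof.
move=> BB' [d [v [vbar vB]]].
pose phi k (x : V k) := \sum_r coords (B k) x r 0 *: tnth (B' k) r.
have phiE k x : coords (B' k) (phi k x) = coords (B k) x.
  by rewrite coords_sum; apply/colP => r; rewrite mxE.
have phi_map (k : 'I_l) x : pm_map V k (phi _ x) = phi _ (pm_map V k x).
  by apply: (@coords_inj _ _ _ B'); rewrite phiE !coords_map phiE BB'.
have phi0 k : phi k 0 = 0.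
  by apply: big1 => r _; rewrite mxE linear0 scale0r.
have phiB k : map (phi k) (B k) = B' k.
  apply: (@eq_from_nth _ 0) => [|c]; rewrite size_map !size_tuple // => lt_c.
  rewrite (nth_map 0) ?size_tuple //; apply: (@coords_inj _ _ _ B').
  rewrite phiE -[c]/(nat_of_ord (Ordinal lt_c)); apply/colP => s.
  by rewrite !mxE !coord_free ?bf_free.
exists d, (fun i j m k => phi k (v i j m k)); split=> [i j m le_ij|k].
  have [vin vout] := vbar i j m le_ij; split=> k hk; rewrite phi_map.
    by rewrite vin.
  by rewrite vout // phi0.
rewrite -phiB -vB map_flatten -map_comp; congr flatten; apply: eq_map => i /=.
rewrite map_flatten -map_comp; congr flatten; apply: eq_map => j /=.
by rewrite -map_comp.
Qed.

End Barcodes.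

Theorem proposition3p7 (F : fieldType) (l : nat) (V : persistence_module F l)
    (B : basis_family V) (HB : ordered_barcode_basis B) :
  forall B' : basis_family V,
    ordered_barcode_basis B' <->
    exists g : GL_family V, in_Stab (map_matrix B) g /\ B' = act g B.
Proof.
move=> B'; split=> [HB'|[g [gS ->]]]; last first.
  by apply: barcode_basis_transport HB => i; rewrite map_matrix_act gS.
have [g B'E] := act_transitive B B'; exists g; split=> // i.
have [d [w wB]] := barcode_basis_indexed HB.
have [d' [w' wB']] := barcode_basis_indexed HB'.
have dd' := multiplicities_unique (barcode_rank wB wB').
rewrite -map_matrix_act -B'E; apply/esym; apply: barcode_map_matrix wB _ i.
(* The lists of alive bars for [d] and [d'] coincide, so [w'] also presents [B'] with multiplicities
   [d]. *)
case: wB' => w'map w'B'; split=> k; rewrite (alive_indices_eq _ dd').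
  exact: w'map.
exact: w'B'.
Qed.
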